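(* In the two-dimensional setting of the context, assume that $\boldsymbol{E}\in W^{1,\infty}$ and that $\tilde\Omega_y$ and $\Omega_x$ are compact, and fix a finite time $T>0$. Let $\tau=\Delta t/\varepsilon$, $\lambda=\Delta t/\varepsilon^2$, and let $(y^n,v^n)$ be the solution of the first order semi-implicit scheme $$y^{n+1}=y^n+\tau N(y^n)^{T}v^{n+1},\qquad v^{n+1}=v^n+\tau N(y^n)\tilde{\boldsymbol{E}}(y^n)+\lambda\, b(F(y^n))K v^{n+1},$$ for $n\Delta t\le T$, with initial data $(y^0,v^0)$. Let $u^n$ be the numerical solution of the guiding-center model $$u^{n+1}=u^n+\Delta t\,\mathcal{R}(u^n),\qquad u^0=y^0,\qquad \mathcal{R}(u)=\frac{K\tilde{\boldsymbol{E}}(u)}{b_0\,\mathbb{J}(u)}.$$ Then there exists $\lambda_0$ such that, when $\lambda\ge\lambda_0$, $$\|y^n-u^n\|\lesssim\varepsilon^2\Big(1+\big\|\varepsilon^{-1}v^0-(b^0)^{-1}KN(y^0)\tilde{\boldsymbol{E}}(y^0)\big\|\Big)$$ for all $n$ with $n\Delta t\le T$, where $b^0=b(F(y^0))$.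
   Context: Setting: $F:\tilde\Omega_y\to\Omega_x$, $\tilde\Omega_y,\Omega_x\subset\mathbb{R}^2$, $F(y)=x$, is a bijective (smooth) orthogonal change of coordinates with Jacobi matrix $(D_F(y))_{ij}=\partial x_i/\partial y_j$ whose columns are mutually orthogonal, $\mathbb{J}(y)=\det D_F(y)>0$, and $N(y)=D_F(y)^{-T}$. The matrix $K=\begin{pmatrix}0&1\\-1&0\end{pmatrix}$. The transformed electric field $\tilde{\boldsymbol{E}}$ is defined by $\boldsymbol{E}(x)=N(y)\tilde{\boldsymbol{E}}(y)$ for $x=F(y)$. The magnetic field is $\frac1\varepsilon(0,0,b(x))^\top$ with $\tilde b(y):=b(F(y))$, in the maximal ordering $\tilde b(y)=\bar b(\varepsilon y)$ for a fixed function $\bar b$, and $b_0=\tilde b(0)\ne0$. The scheme discretizes, with time step $\Delta t$, the system $\varepsilon\dot y=N(y)^\top v$, $\varepsilon\dot v=N(y)\tilde{\boldsymbol{E}}(y)+\frac{\tilde b(y)K}{\varepsilon}v$. Here $y^n,u^n\in\tilde\Omega_y$, $v^n\in\mathbb{R}^2$. Notation: $A\lesssim B$ means $A\le CB$ with a constant $C>0$ independent of $\varepsilon$, $\Delta t$, $n$ and $v^0$ (it may depend on $T$, $\lambda_0$, $b_0$ and on bounds for the fields and the coordinate map).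
   Formalization: For general b̄ the ε² rate fails (F = id, E = (0,1), b̄(z) = 1+z₁: one step with Δt = 1 gives an error of order ε), so the formal theorem also assumes |b̄(εy) − b̄(0)| ≤ Mε² for some M, all 0 < ε ≤ 1 and all y in Ω̃_y. *)

(* Defs.v *)
From HB Require Import structures.
From mathcomp Require Import all_boot all_order all_algebra.
From mathcomp Require Import all_classical all_reals all_analysis.
Set Implicit Arguments.
Unset Strict Implicit.
Unset Printing Implicit Defensive.
Import Order.TTheory GRing.Theory Num.Theory.
Import numFieldNormedType.Exports.
Local Open Scope classical_set_scope.
Local Open Scope ring_scope.

(* Vectors of R^2 are columns 'cV[R]_2. The library norm `|v| on matrices is
   the max norm; the Euclidean norm is [enorm]. *)
Definition enorm (R : realType) (v : 'cV[R]_2) : R :=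
  Num.sqrt (\sum_(i < 2) v i 0 ^+ 2).

Definition Kmx (R : realType) : 'M[R]_2 :=
  \matrix_(i < 2, j < 2) ((i < j)%N%:R - (j < i)%N%:R).

Definition partial (R : realType) (j : 'I_2) (f : 'cV[R]_2 -> R) :
  'cV[R]_2 -> R := fun y => 'D_(delta_mx j 0) f y.

Definition iter_partial (R : realType) (s : seq 'I_2) (f : 'cV[R]_2 -> R) :
  'cV[R]_2 -> R := foldr (@partial R) f s.

(* C^infinity on the open set U. Existence of the partial derivatives has to be
   requested explicitly, because 'D_v f y is a junk value where it does not
   exist. *)
Definition smooth_on (R : realType) (U : set 'cV[R]_2)
    (F : 'cV[R]_2 -> 'cV[R]_2) : Prop :=
  forall (i : 'I_2) (s : seq 'I_2) (y : 'cV[R]_2), U y ->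
    {for y, continuous (iter_partial s (fun z => F z i 0))} /\
    forall j : 'I_2,
      derivable (iter_partial s (fun z => F z i 0)) y (delta_mx j 0).

Definition jacobi_mx (R : realType) (F : 'cV[R]_2 -> 'cV[R]_2)
    (y : 'cV[R]_2) : 'M[R]_2 :=
  \matrix_(i < 2, j < 2) partial j (fun z => F z i 0) y.

Definition jac (R : realType) (F : 'cV[R]_2 -> 'cV[R]_2) (y : 'cV[R]_2) : R :=
  \det (jacobi_mx F y).

Definition Nmx (R : realType) (F : 'cV[R]_2 -> 'cV[R]_2) (y : 'cV[R]_2) :
  'M[R]_2 := (invmx (jacobi_mx F y))^T.

(* Only the restriction of F to the compact set Oy is the change of coordinates;
   smoothness up to the boundary is smoothness on an open neighbourhood of Oy.
   The off-diagonal entries of D^T D are the products of distinct columns of D. *)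
Record orthogonal_coordinates (R : realType) (Oy Ox : set 'cV[R]_2)
    (F : 'cV[R]_2 -> 'cV[R]_2) : Prop := OrthogonalCoordinates {
  oc_bij : set_bij Oy Ox F;
  oc_smooth : exists U : set 'cV[R]_2, [/\ open U, Oy `<=` U & smooth_on U F];
  oc_orthogonal : forall y, Oy y ->
    is_diag_mx ((jacobi_mx F y)^T *m jacobi_mx F y);
  oc_jac_gt0 : forall y, Oy y -> 0 < jac F y }.

(* W^{1,oo} with its Lipschitz representative: bounded and Lipschitz on A. *)
Definition W1infty_on (R : realType) (A : set 'cV[R]_2)
    (E : 'cV[R]_2 -> 'cV[R]_2) : Prop :=
  [bounded E x | x in A] /\ [lipschitz E x | x in A].

(* The steps leading to the discrete times up to T. [b] is the unscaled field,
   as a function of x; the step is implicit in v only. *)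
Definition semi_implicit_scheme (R : realType) (F : 'cV[R]_2 -> 'cV[R]_2)
    (Et : 'cV[R]_2 -> 'cV[R]_2) (b : 'cV[R]_2 -> R) (eps dt T : R)
    (y v : nat -> 'cV[R]_2) : Prop :=
  forall n : nat, n.+1%:R * dt <= T ->
    y n.+1 = y n + (dt / eps) *: ((Nmx F (y n))^T *m v n.+1) /\
    v n.+1 = v n + (dt / eps) *: (Nmx F (y n) *m Et (y n))
                 + (dt / eps ^+ 2 * b (F (y n))) *: (Kmx R *m v n.+1).

Definition gc_field (R : realType) (F : 'cV[R]_2 -> 'cV[R]_2)
    (Et : 'cV[R]_2 -> 'cV[R]_2) (b0 : R) (u : 'cV[R]_2) : 'cV[R]_2 :=
  (b0 * jac F u)^-1 *: (Kmx R *m Et u).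

Definition guiding_center_scheme (R : realType) (F : 'cV[R]_2 -> 'cV[R]_2)
    (Et : 'cV[R]_2 -> 'cV[R]_2) (b0 dt T : R) (u : nat -> 'cV[R]_2) : Prop :=
  forall n : nat, n.+1%:R * dt <= T ->
    u n.+1 = u n + dt *: gc_field F Et b0 (u n).

(* Main.v *)
Require Import Defs.
From HB Require Import structures.
From mathcomp Require Import all_boot all_order all_algebra.
From mathcomp Require Import all_classical all_reals all_analysis.
From mathcomp Require Import ring lra.
Import Order.TTheory GRing.Theory Num.Theory.
Import numFieldNormedType.Exports.
Local Open Scope classical_set_scope.
Local Open Scope ring_scope.

(** Write [G y = N(y) Et(y)] (which is [E (F y)]), [b_n = b (F (y_n))],
    [lambda = dt / eps^2] and [tau = dt / eps].

    The velocity splits as [v_(n+1) = (eps / b_n) K G(y_n) + w_n], a drift plus a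
    fast part. Since [K^2 = -1], the drift balances the electric force exactly,
    so that [w_n = z_n + lambda b_n K w_n] with [z_n = v_n - (eps / b_n) K G(y_n)]
    ([fast_part_step]); as [K] is an isometry, the norm of [w_n] is at most
    that of [z_n] times [O(1 / lambda)] ([resolvent_le]). On the other hand
    [N^T K N = K / J] in dimension two, so the drift moves [y] by
    [dt (b0 / b_n) R(y_n)] ([gc_field_drift]), where [R] is the guiding-center
    field and [b0 / b_n = 1 + O(eps^2)] by the maximal ordering. The scheme is thus
    the Euler scheme of the guiding center, perturbed by [dt O(eps^2)] and by
    [tau N^T w_n].

    It remains to sum [tau w_n]. From one step to the next
    [z_(n+1) = w_n + (drift at y_n - drift at y_(n+1))], and the difference of the
    drifts is [O(eps dt + dt w_n)] ([drift_variation]). For [lambda] large this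
    gives [w_(n+1) <= w_n / 2 + O(eps dt / lambda)], while
    [w_0 = O(eps W / lambda)], [W] being the norm in the statement. Hence
    [sum w_n = O((eps / lambda) (1 + W))] over a bounded time ([sum_halving]), and
    [tau eps / lambda = eps^2]. The discrete Gronwall inequality
    ([discrete_gronwall]) concludes.

    This uses that [G] and [R] are bounded and Lipschitz on the compact set [Oy],
    although [Oy] need not be convex: the derivatives of [F] are locally Lipschitz
    near [Oy], and compactness turns this into a global Lipschitz bound
    ([locally_lipschitz_on_compact]). When [eps] is bounded below, the estimate
    only says that [Oy] is bounded. Everything is done in the max norm, which is
    equivalent to the Euclidean one. *)

Set Implicit Arguments.
Unset Strict Implicit.

(** * Two discrete inequalities *)

Lemma discrete_gronwall (R : realType) (e r : nat -> R) (a : R) (n : nat) :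
  0 <= a -> (forall k, (k < n)%N -> 0 <= r k) -> e 0%N = 0 ->
  (forall k, (k < n)%N -> e k.+1 <= (1 + a) * e k + r k) ->
  e n <= expR (n%:R * a) * \sum_(k < n) r k.
Proof.
move=> a0 r0 e0 eS.
have a1 : 1 <= 1 + a by lra.
suff h m : (m <= n)%N -> e m <= (1 + a) ^+ m * \sum_(k < m) r k.
  apply: (le_trans (h n (leqnn n))); apply: ler_wpM2r.
    by apply: sumr_ge0 => k _; exact: r0.
  by rewrite expRM_natl lerXn2r ?nnegrE ?expR_ge0 ?expR_ge1Dx//; lra.
elim: m => [_|m IH mn]; first by rewrite big_ord0 mulr0 e0.
rewrite big_ord_recr/= mulrDr exprS -mulrA.
apply: (le_trans (eS m mn)); apply: lerD.
  by apply: ler_wpM2l; [lra | exact/IH/ltnW].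
by apply: ler_peMl; [exact: r0 | rewrite -exprS exprn_ege1].
Qed.

(** The extra term [w n] on the left is what makes the induction go through: a
    step adds [2 * w n.+1 - w n], which halving bounds by [2 * d]. *)
Lemma sum_halving (R : realType) (w : nat -> R) (d : R) (n : nat) :
  (forall k, (k < n)%N -> w k.+1 <= w k / 2 + d) ->
  \sum_(k < n.+1) w k + w n <= 2 * (w 0%N + n%:R * d).
Proof.
elim: n => [|n IH] wS; first by rewrite big_ord1 /=; lra.
have := IH (fun k kn => wS k (ltnW kn)).
have := wS n (ltnSn n).
rewrite [\sum_(k < n.+2) _]big_ord_recr/= -[n.+1%:R]natr1; lra.
Qed.

(** * The max norm *)

Lemma coord_le_norm (R : realType) m n (A : 'M[R]_(m.+1, n.+1)) i j :
  `|A i j| <= `|A|.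
Proof.
rewrite {2}/Num.norm/= mx_normrE.
exact: (le_bigmax_cond _ (fun ij : 'I_m.+1 * 'I_n.+1 => `|A ij.1 ij.2|) (j := (i, j))).
Qed.

Lemma norm_le_coord (R : realType) m n (A : 'M[R]_(m.+1, n.+1)) (c : R) :
  0 <= c -> (forall i j, `|A i j| <= c) -> `|A| <= c.
Proof.
move=> c0 Ac; rewrite {1}/Num.norm/= mx_normrE.
by apply/bigmax_leP; split=> // -[i j] _; exact: Ac.
Qed.

Lemma norm_mulmx_le (R : realType) m n p (A : 'M[R]_(m.+1, n.+1))
    (B : 'M[R]_(n.+1, p.+1)) : `|A *m B| <= n.+1%:R * `|A| * `|B|.
Proof.
apply: norm_le_coord => [|i j]; first by rewrite !mulr_ge0.
rewrite mxE; apply: (le_trans (ler_norm_sum _ _ _)).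
have -> : n.+1%:R * `|A| * `|B| = \sum_(k < n.+1) `|A| * `|B|.
  by rewrite sumr_const card_ord -mulrA mulr_natl.
by apply: ler_sum => k _; rewrite normrM ler_pM ?coord_le_norm.
Qed.

Lemma norm_trmx (R : realType) m n (A : 'M[R]_(m.+1, n.+1)) : `|A^T| = `|A|.
Proof.
apply/eqP; rewrite eq_le; apply/andP; split.
  by apply: norm_le_coord => // i j; rewrite mxE coord_le_norm.
by apply: norm_le_coord => // i j; have := coord_le_norm A^T j i; rewrite mxE.
Qed.

Lemma ord2P (P : 'I_2 -> Prop) : P 0 -> P 1 -> forall i, P i.
Proof.
by move=> P0 P1 [[|[|//]] i2]; [rewrite (_ : Ordinal _ = 0)|rewrite (_ : Ordinal _ = 1)];
  do ?exact: val_inj.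
Qed.

Lemma big_ord2 (R : realType) (f : 'I_2 -> R) : \sum_(i < 2) f i = f 0 + f 1.
Proof. by rewrite !big_ord_recl big_ord0 addr0; congr (_ + f _); exact: val_inj. Qed.

Lemma det_mx2 (R : realType) (A : 'M[R]_2) :
  \det A = A 0 0 * A 1 1 - A 0 1 * A 1 0.
Proof.
rewrite (expand_det_row _ 0) big_ord2 /cofactor !det_mx11 !mxE /=.
have -> : lift (0 : 'I_2) (0 : 'I_1) = 1 by exact: val_inj.
have -> : lift (1 : 'I_2) (0 : 'I_1) = 0 by exact: val_inj.
by rewrite expr0 expr1; ring.
Qed.

Lemma Kmx_col0 (R : realType) (v : 'cV[R]_2) : (Kmx R *m v) 0 0 = v 1 0.
Proof. by rewrite !mxE big_ord2 !mxE/=; ring. Qed.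

Lemma Kmx_col1 (R : realType) (v : 'cV[R]_2) : (Kmx R *m v) 1 0 = - v 0 0.
Proof. by rewrite !mxE big_ord2 !mxE/=; ring. Qed.

Lemma Kmx_sqr (R : realType) (v : 'cV[R]_2) : Kmx R *m (Kmx R *m v) = - v.
Proof.
apply/colP; apply: ord2P; first by rewrite Kmx_col0 Kmx_col1 !mxE.
by rewrite Kmx_col1 Kmx_col0 !mxE.
Qed.

Lemma norm_Kmx (R : realType) (v : 'cV[R]_2) : `|Kmx R *m v| = `|v|.
Proof.
have Kle (u : 'cV[R]_2) : `|Kmx R *m u| <= `|u|.
  apply: norm_le_coord => // i j; rewrite (ord1 j); move: i; apply: ord2P.
    by rewrite Kmx_col0 coord_le_norm.
  by rewrite Kmx_col1 normrN coord_le_norm.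
apply/eqP; rewrite eq_le Kle/=.
by rewrite -[leLHS]normrN -Kmx_sqr Kle.
Qed.

(** In dimension two [Kmx] is the matrix of the area form, so a linear change
    of coordinates only scales it, by the determinant. *)
Lemma trmx_Kmx_mul (R : realType) (A : 'M[R]_2) :
  A^T *m Kmx R *m A = \det A *: Kmx R.
Proof.
rewrite det_mx2; apply/matrixP; apply: ord2P; apply: ord2P;
  rewrite !mxE !big_ord2 !mxE !big_ord2 !mxE/=; ring.
Qed.

Lemma enorm_le_norm (R : realType) (v : 'cV[R]_2) : enorm v <= 2 * `|v|.
Proof.
rewrite /enorm big_ord2 -[leRHS]ger0_norm ?mulr_ge0// -sqrtr_sqr ler_wsqrtr//.
have sq i : v i 0 ^+ 2 <= `|v| ^+ 2.
  by rewrite -real_normK ?num_real// lerXn2r ?nnegrE// coord_le_norm.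
have := sq 0; have := sq 1; have := sqr_ge0 `|v|; rewrite exprMn; lra.
Qed.

Lemma norm_le_enorm (R : realType) (v : 'cV[R]_2) : `|v| <= enorm v.
Proof.
have sq i : v i 0 ^+ 2 <= v 0 0 ^+ 2 + v 1 0 ^+ 2.
  by move: i; apply: ord2P; rewrite ?lerDl ?lerDr sqr_ge0.
apply: norm_le_coord => [|i j]; first exact: sqrtr_ge0.
by rewrite (ord1 j) /enorm big_ord2 -sqrtr_sqr ler_wsqrtr.
Qed.

(** * Bounded Lipschitz maps *)

(** One constant for both bounds makes the class stable under products by a single
    computation, [bounded_lipschitz_bilinear]. *)
Definition bounded_lipschitz (R : realType) (V W : normedModType R)
    (A : set V) (f : V -> W) : Prop :=
  exists2 k : R, 0 <= k & forall x y, A x -> A y ->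
    `|f x| <= k /\ `|f x - f y| <= k * `|x - y|.

Lemma W1infty_bounded_lipschitz (R : realType) (A : set 'cV[R]_2)
    (E : 'cV[R]_2 -> 'cV[R]_2) : W1infty_on A E -> bounded_lipschitz A E.
Proof.
move=> [bE /pinfty_ex_gt0 [k2 k20 lE]]; have [k1 k10 bE1] := pinfty_ex_gt0 bE.
exists (k1 + k2) => [|x y Ax Ay]; first by rewrite addr_ge0// ltW.
split; first by apply: (le_trans (bE1 x Ax)); rewrite lerDl ltW.
apply: (le_trans (lE (x, y) (conj Ax Ay))) => /=.
by rewrite ler_wpM2r// lerDr ltW.
Qed.

Lemma bounded_lipschitz_cst (R : realType) (V W : normedModType R) (A : set V)
    (c : W) : bounded_lipschitz A (fun=> c).
Proof.
by exists `|c| => // x y _ _; rewrite subrr normr0 lexx; split => //; rewrite mulr_ge0.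
Qed.

Lemma bounded_lipschitz_comp (R : realType) (V W Z : normedModType R)
    (A : set V) (B : set W) (f : V -> W) (g : W -> Z) :
  (forall x, A x -> B (f x)) -> bounded_lipschitz A f ->
  bounded_lipschitz B g -> bounded_lipschitz A (g \o f).
Proof.
move=> AB [k k0 fk] [l l0 gl]; exists (l + l * k); first by rewrite addr_ge0// mulr_ge0.
move=> x y Ax Ay; have [gx gxy] := gl _ _ (AB x Ax) (AB y Ay); split => /=.
  by apply: (le_trans gx); rewrite lerDl mulr_ge0.
apply: (le_trans gxy); rewrite mulrDl -mulrA.
apply: (@le_trans _ _ (l * (k * `|x - y|))).
  by rewrite ler_wpM2l// (fk _ _ Ax Ay).2.
by rewrite lerDr mulr_ge0.
Qed.

Lemma bounded_lipschitz_bilinear (R : realType) (V W1 W2 W3 : normedModType R)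
    (A : set V) (op : W1 -> W2 -> W3) (c : R) (f : V -> W1) (g : V -> W2) :
  0 <= c -> (forall a b, `|op a b| <= c * `|a| * `|b|) ->
  (forall a a' b, op a b - op a' b = op (a - a') b) ->
  (forall a b b', op a b - op a b' = op a (b - b')) ->
  bounded_lipschitz A f -> bounded_lipschitz A g ->
  bounded_lipschitz A (fun x => op (f x) (g x)).
Proof.
move=> c0 opc opBl opBr [k k0 fk] [l l0 gl].
exists (2 * (c * k * l) + c * k * l) => [|x y Ax Ay].
  by rewrite addr_ge0// !mulr_ge0.
have [fx fxy] := fk _ _ Ax Ay; have [gx gxy] := gl _ _ Ax Ay.
have [fy _] := fk _ _ Ay Ax; split.
  apply: (le_trans (opc _ _)); apply: (@le_trans _ _ (c * k * l)).
    by rewrite ler_pM ?mulr_ge0// ler_wpM2l.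
  by rewrite lerDr !mulr_ge0.
have -> : op (f x) (g x) - op (f y) (g y) =
    op (f x - f y) (g x) + op (f y) (g x - g y).
  by rewrite -opBl -opBr addrA subrK.
apply: (le_trans (ler_normD _ _)).
apply: (@le_trans _ _ (c * (k * `|x - y|) * l + c * k * (l * `|x - y|))).
  apply: lerD; apply: (le_trans (opc _ _)).
    by rewrite ler_pM ?mulr_ge0// ler_wpM2l.
  by rewrite ler_pM ?mulr_ge0// ler_wpM2l.
have := normr_ge0 (x - y).
have -> : c * (k * `|x - y|) * l + c * k * (l * `|x - y|) =
  2 * (c * k * l) * `|x - y| by ring.
by move=> xy0; rewrite ler_wpM2r// lerDl !mulr_ge0.
Qed.

Lemma bounded_lipschitzD (R : realType) (V W : normedModType R)
    (A : set V) (f g : V -> W) :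
  bounded_lipschitz A f -> bounded_lipschitz A g ->
  bounded_lipschitz A (fun x => f x + g x).
Proof.
move=> [k k0 fk] [l l0 gl]; exists (k + l) => [|x y Ax Ay]; first exact: addr_ge0.
have [fx fxy] := fk _ _ Ax Ay; have [gx gxy] := gl _ _ Ax Ay; split.
  by apply: (le_trans (ler_normD _ _)); exact: lerD.
rewrite opprD addrACA mulrDl.
by apply: (le_trans (ler_normD _ _)); exact: lerD.
Qed.

Lemma bounded_lipschitzZ (R : realType) (V W : normedModType R)
    (A : set V) (f : V -> R) (g : V -> W) :
  bounded_lipschitz A (f : V -> R^o) -> bounded_lipschitz A g ->
  bounded_lipschitz A (fun x => f x *: g x).
Proof.
apply: (@bounded_lipschitz_bilinear R V R^o W W A (fun a b => a *: b) 1) => // [a b|a a' b|a b b'].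
- by rewrite normrZ mul1r.
- by rewrite scalerBl.
- by rewrite scalerBr.
Qed.

Lemma bounded_lipschitz_mulmx (R : realType) (V : normedModType R) m n p
    (A : set V) (f : V -> 'M[R]_(m.+1, n.+1)) (g : V -> 'M[R]_(n.+1, p.+1)) :
  bounded_lipschitz A f -> bounded_lipschitz A g ->
  bounded_lipschitz A (fun x => f x *m g x).
Proof.
apply: (@bounded_lipschitz_bilinear _ _ _ _ _ _ (fun a b => a *m b) n.+1%:R) => // [a b|a a' b|a b b'].
- exact: norm_mulmx_le.
- by rewrite mulmxBl.
- by rewrite mulmxBr.
Qed.

Lemma bounded_lipschitz_matrix (R : realType) (V : normedModType R) m n
    (A : set V) (f : V -> 'M[R]_(m.+1, n.+1)) :
  (forall i j, bounded_lipschitz A (fun x => f x i j : R^o)) ->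
  bounded_lipschitz A f.
Proof.
move=> fij.
have /choice[k kP] : forall ij : 'I_m.+1 * 'I_n.+1, exists k, 0 <= k /\
    forall x y, A x -> A y -> `|f x ij.1 ij.2| <= k /\
      `|f x ij.1 ij.2 - f y ij.1 ij.2| <= k * `|x - y|.
  by move=> [i j]; have [k k0 kP] := fij i j; exists k.
have k0 ij : 0 <= k ij by case: (kP ij).
have kS i j : k (i, j) <= \sum_ij k ij.
  by rewrite (bigD1 (i, j))//= lerDl sumr_ge0.
exists (\sum_ij k ij) => [|x y Ax Ay]; first by rewrite sumr_ge0.
split; apply: norm_le_coord => [|i j]; rewrite ?mulr_ge0 ?sumr_ge0//.
  by have [_ /(_ x y Ax Ay)[+ _]] := kP (i, j) => /le_trans; apply.
rewrite !mxE; have [_ /(_ x y Ax Ay)[_ +]] := kP (i, j) => /le_trans; apply.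
by rewrite ler_wpM2r.
Qed.

(** * Continuously differentiable functions on a compact set *)

(** Compactness is used as a covering property in which the bound [k], going to
    infinity, is the parameter: it suffices to find [k] near each point. *)
Lemma continuous_bounded_on_compact (R : realType) (V W : normedModType R)
    (A : set V) (f : V -> W) :
  compact A -> (forall x, A x -> {for x, continuous f}) ->
  exists2 k : R, 0 <= k & forall x, A x -> `|f x| <= k.
Proof.
move=> /compact_near_coveringP cA cf.
have : \forall k \near +oo, A `<=` (fun x => `|f x| <= k).
  apply: cA => x Ax; near=> x' k => /=.
  apply: (@le_trans _ _ (`|f x| + 1)).
    apply: ltW; near: x'.
    by apply: (cvgr_norm_lt _ (cf x Ax)); rewrite ltrDl.
  by near: k; apply: nbhs_pinfty_ge; rewrite num_real.
by move/pinfty_ex_gt0 => [k k0 fk]; exists k => //; exact: ltW.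
Unshelve. all: end_near. Qed.

(** Two points of [A] near a common point are controlled by the local constant;
    two points at a distance bounded below are controlled by the bound on [f]. *)
Lemma locally_lipschitz_on_compact (R : realType) (V W : normedModType R)
    (A : set V) (f : V -> W) :
  compact A -> (forall x, A x -> {for x, continuous f}) ->
  (forall x, A x -> exists r k : R, 0 < r /\
    forall y z, ball x r y -> ball x r z -> `|f y - f z| <= k * `|y - z|) ->
  bounded_lipschitz A f.
Proof.
move=> cA cf lf; have [B B0 fB] := continuous_bounded_on_compact cA cf.
move/compact_near_coveringP : cA => cA.
have : \forall k \near +oo, A `<=`
    (fun y => A y -> forall z, A z -> `|f y - f z| <= k * `|y - z|).
  apply: cA => x Ax; have [r [l [r0 lP]]] := lf x Ax.
  have r20 : 0 < r / 2 by rewrite divr_gt0.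
  near=> y k => /= Ay z Az.
  have xy : ball x (r / 2) y by near: y; exact: nbhsx_ballx.
  have [yz|yz] := ltP `|y - z| (r / 2).
    apply: (@le_trans _ _ (l * `|y - z|)).
      apply: lP; first by apply: le_ball xy; lra.
      by rewrite (splitr r); apply: (ball_triangle xy); rewrite -ball_normE /ball_/=.
    by rewrite ler_wpM2r//; near: k; apply: nbhs_pinfty_ge; rewrite num_real.
  apply: (@le_trans _ _ (B + B)).
    by apply: (le_trans (ler_normB _ _)); rewrite lerD ?fB.
  rewrite -(mulfVK (lt0r_neq0 r20) (B + B)).
  have kB : (B + B) / (r / 2) <= k by near: k; apply: nbhs_pinfty_ge; rewrite num_real.
  apply: ler_pM => //; first by rewrite divr_ge0 ?addr_ge0// ltW.
  exact: ltW.
move/pinfty_ex_gt0 => [k k0 fk]; exists (B + k) => [|x y Ax Ay].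
  by rewrite addr_ge0// ltW.
split; first by apply: (le_trans (fB x Ax)); rewrite lerDl ltW.
by apply: (le_trans (fk x Ax Ax y Ay)); rewrite ler_wpM2r// lerDr.
Unshelve. all: end_near. Qed.

Lemma bounded_lipschitzV (R : realType) (V : normedModType R) (A : set V)
    (f : V -> R) :
  compact A -> (forall x, A x -> {for x, continuous f}) ->
  (forall x, A x -> f x != 0) -> bounded_lipschitz A (f : V -> R^o) ->
  bounded_lipschitz A (fun x => (f x)^-1 : R^o).
Proof.
move=> cA cf f0 [k k0 fk].
have [B B0 fB] : exists2 k : R, 0 <= k & forall x, A x -> `|(f x)^-1| <= k.
  apply: (@continuous_bounded_on_compact R V R^o) => // x Ax.
  by apply: cvgV; [exact: f0 | exact: cf].
exists (B + B * k * B) => [|x y Ax Ay]; first by rewrite addr_ge0// !mulr_ge0.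
split; first by apply: (le_trans (fB x Ax)); rewrite lerDl !mulr_ge0.
have -> : (f x)^-1 - (f y)^-1 = (f x)^-1 * (f y - f x) * (f y)^-1.
  by field; rewrite !f0.
apply: (@le_trans _ _ (B * (k * `|x - y|) * B)).
  by rewrite !normrM !ler_pM ?mulr_ge0 ?fB// distrC (fk _ _ Ax Ay).2.
rewrite mulrDl; apply: (@le_trans _ _ (B * k * B * `|x - y|)).
  by rewrite le_eqVlt; apply/orP; left; apply/eqP; ring.
by rewrite lerDr mulr_ge0.
Qed.

Lemma is_derive_line (R : realType) (V W : normedModType R) (f : V -> W)
    (z e : V) (t : R) :
  derivable f (z + t *: e) e ->
  is_derive t (1 : R) (fun s : R => f (z + s *: e)) ('D_e f (z + t *: e)).
Proof.
move=> df.
have E : (fun h : R => h^-1 *: (((fun s : R => f (z + s *: e)) \o shift t) (h *: (1 : R))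
      - f (z + t *: e))) =
    (fun h : R => h^-1 *: ((f \o shift (z + t *: e)) (h *: e) - f (z + t *: e))).
  apply/funext => h /=; congr (_ *: (f _ - _)).
  by rewrite [h *: (1 : R)]mulr1 scalerDl addrCA.
by split; rewrite ?/derivable ?/derive E.
Qed.

Lemma ball_segment (R : realType) (V : normedModType R) (x z e : V) (r d t : R) :
  0 <= t <= d -> ball x r z -> ball x r (z + d *: e) -> ball x r (z + t *: e).
Proof.
move=> /andP[]; rewrite le_eqVlt => /predU1P[<-|t0 td]; first by rewrite scale0r addr0.
have d0 : 0 < d by exact: lt_le_trans td.
rewrite -!ball_normE /= => xz xzd.
have -> : x - (z + t *: e) = (1 - t / d) *: (x - z) + (t / d) *: (x - (z + d *: e)).
  rewrite !opprD !addrA; move: (x - z) => a.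
  by rewrite scalerBl scale1r scalerBr scalerA divfK ?gt_eqF// addrA subrK.
have td1 : t / d <= 1 by rewrite ler_pdivrMr// mul1r.
have td0 : 0 < t / d by rewrite divr_gt0.
apply: (le_lt_trans (ler_normD _ _)); rewrite 2!normrZ.
rewrite [`|1 - _|]ger0_norm ?subr_ge0// [`|t / d|]ger0_norm ?ltW//.
move: td0 td1; set s := t / d => s0 s1.
rewrite (_ : r = (1 - s) * r + s * r); last by ring.
by apply: ler_ltD; rewrite ?ltr_pM2l// ler_wpM2l ?subr_ge0// ltW.
Qed.

Lemma partial_increment (R : realType) (V : normedModType R) (f : V -> R)
    (x z e : V) (r k d : R) :
  (forall y, ball x r y -> derivable f y e /\ `|'D_e f y| <= k) ->
  ball x r z -> ball x r (z + d *: e) ->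
  `|f (z + d *: e) - f z| <= k * `|d|.
Proof.
move=> fk; wlog d0 : z d / 0 <= d => [wl xz xzd|xz xzd].
  have [d0|d0] := leP 0 d; first exact: wl.
  rewrite distrC -[d in leRHS]opprK normrN.
  have := wl (z + d *: e) (- d); rewrite scaleNr addrK; apply => //.
  by rewrite oppr_ge0 ltW.
pose h (s : R) := f (z + s *: e).
have dh s : s \in `[0, d]%R -> is_derive s (1 : R) h ('D_e f (z + s *: e)).
  rewrite in_itv/= => s0d; apply: is_derive_line.
  by have [] := fk _ (ball_segment s0d xz xzd).
have ch : {within [set` `[0, d]], continuous h}.
  by apply: derivable_within_continuous => s s0d; have [] := dh s s0d.
have dh' s : s \in `]0, d[%R -> is_derive s (1 : R) h ('D_e f (z + s *: e)).
  by move=> s0d; apply: dh; exact: subset_itv_oo_cc.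
have [c c0d hc] := MVT_segment d0 dh' ch.
have -> : f (z + d *: e) - f z = h d - h 0 by rewrite /h scale0r addr0.
rewrite hc subr0 normrM ler_wpM2r//; move: c0d; rewrite in_itv/= => c0d.
by have [] := fk _ (ball_segment c0d xz xzd).
Qed.

(** Balls of the max norm are squares, so two points of a ball are joined inside
    it by a segment in each coordinate direction, along which the mean value
    theorem applies to one partial derivative. *)
Lemma partials_locally_lipschitz (R : realType) (U : set 'cV[R]_2)
    (f : 'cV[R]_2 -> R) :
  open U ->
  (forall y, U y -> forall j : 'I_2, derivable f y (delta_mx j 0) /\
     {for y, continuous (partial j f)}) ->
  forall x, U x -> exists r k : R, 0 < r /\
    forall y z, ball x r y -> ball x r z -> `|f y - f z| <= k * `|y - z|.
Proof.
move=> oU df x Ux.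
pose k := `|partial 0 f x| + `|partial 1 f x| + 1.
have nk j : \forall y \near x, `|partial j f y| < k.
  apply: (cvgr_norm_lt _ (df x Ux j).2); rewrite /k.
  have := normr_ge0 (partial 0 f x); have := normr_ge0 (partial 1 f x).
  by move: j; apply: ord2P => a0 b0; lra.
have : \forall y \near x, U y /\ (forall j : 'I_2, `|partial j f y| <= k).
  near=> y; split; first by near: y; exact: open_nbhs_nbhs.
  by apply: ord2P; apply: ltW; near: y; exact: nk.
move/nbhs_ballP => [r /= r0 rU]; exists r, (2 * k); split => // y z xy xz.
have kP j w : ball x r w -> derivable f w (delta_mx j 0) /\
    `|'D_(delta_mx j 0) f w| <= k.
  by move=> /rU[Uw wk]; split; [exact: (df w Uw j).1 | exact: wk].
pose m := y + (z 0 0 - y 0 0) *: delta_mx 0 0.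
have mz : m + (z 1 0 - y 1 0) *: delta_mx 1 0 = z.
  by apply/colP; apply: ord2P; rewrite !mxE /=; ring.
have xm : ball x r m.
  move: xy xz; rewrite -!ball_normE /= => xy xz.
  apply: (@le_lt_trans _ _ (Num.max `|x - y| `|x - z|)); last by rewrite gt_max xy.
  apply: norm_le_coord => [|i j]; first by rewrite le_max normr_ge0.
  rewrite (ord1 j) le_max; move: i; apply: ord2P; apply/orP; [right|left].
    by have := coord_le_norm (x - z) 0 0; rewrite !mxE/= mulr1 [y 0 0 + _]addrC subrK.
  by have := coord_le_norm (x - y) 1 0; rewrite !mxE/= mulr0 addr0.
have c0 j : `|z j 0 - y j 0| <= `|y - z|.
  by have := coord_le_norm (y - z) j 0; rewrite !mxE distrC.
have k0 : 0 <= k by rewrite /k !addr_ge0.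
have my : `|f m - f y| <= k * `|y - z|.
  apply: (le_trans (partial_increment (kP 0) xy xm)).
  by rewrite ler_wpM2l.
have zm : `|f z - f m| <= k * `|y - z|.
  rewrite -mz; apply: (le_trans (partial_increment (kP 1) xm _)); rewrite ?mz//.
  by rewrite ler_wpM2l.
have -> : f y - f z = - ((f z - f m) + (f m - f y)) by ring.
rewrite normrN; apply: (le_trans (ler_normD _ _)); lra.
Unshelve. all: end_near. Qed.

Lemma smooth_bounded_lipschitz (R : realType) (A U : set 'cV[R]_2)
    (F : 'cV[R]_2 -> 'cV[R]_2) (i : 'I_2) (s : seq 'I_2) :
  compact A -> open U -> A `<=` U -> smooth_on U F ->
  bounded_lipschitz A (iter_partial s (fun z => F z i 0) : _ -> R^o).
Proof.
move=> cA oU AU sF; apply: (locally_lipschitz_on_compact cA) => [x Ax|x Ax].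
  by have [] := sF i s x (AU _ Ax).
apply: (partials_locally_lipschitz oU) (AU _ Ax) => y Uy j.
by split; [have [_] := sF i s y Uy | have [] := sF i (j :: s) y Uy].
Qed.

(** * The fields in the new coordinates *)

Lemma eq_bounded_lipschitz (R : realType) (V W : normedModType R) (A : set V)
    (f g : V -> W) : (forall x, A x -> f x = g x) ->
  bounded_lipschitz A f -> bounded_lipschitz A g.
Proof.
by move=> fg [k k0 fk]; exists k => // x y Ax Ay; rewrite -!fg//; exact: fk.
Qed.

Lemma jac_continuous (R : realType) (U : set 'cV[R]_2)
    (F : 'cV[R]_2 -> 'cV[R]_2) :
  smooth_on U F -> forall x, U x -> {for x, continuous (jac F)}.
Proof.
move=> sF x Ux; rewrite (_ : jac F = fun y =>
    partial 0 (fun z => F z 0 0) y * partial 1 (fun z => F z 1 0) y -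
    partial 1 (fun z => F z 0 0) y * partial 0 (fun z => F z 1 0) y); last first.
  by apply/funext => y; rewrite /jac det_mx2 !mxE.
have c i j : {for x, continuous (partial j (fun z => F z i 0))}.
  by have [] := sF i [:: j] x Ux.
by apply: continuousB; apply: continuousM; exact: c.
Qed.

Lemma jacobi_mx_bounded_lipschitz (R : realType) (A U : set 'cV[R]_2)
    (F : 'cV[R]_2 -> 'cV[R]_2) :
  compact A -> open U -> A `<=` U -> smooth_on U F ->
  bounded_lipschitz A (jacobi_mx F).
Proof.
move=> cA oU AU sF; apply: bounded_lipschitz_matrix => i j.
apply: eq_bounded_lipschitz (smooth_bounded_lipschitz i [:: j] cA oU AU sF).
by move=> x _; rewrite mxE.
Qed.

Lemma bounded_lipschitz_trmx (R : realType) (V : normedModType R) m n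
    (A : set V) (f : V -> 'M[R]_(m.+1, n.+1)) :
  bounded_lipschitz A f -> bounded_lipschitz A (fun x => (f x)^T).
Proof.
move=> [k k0 fk]; exists k => // x y Ax Ay.
by rewrite norm_trmx -linearB/= norm_trmx; exact: fk.
Qed.

Lemma jacV_bounded_lipschitz (R : realType) (A U : set 'cV[R]_2)
    (F : 'cV[R]_2 -> 'cV[R]_2) :
  compact A -> open U -> A `<=` U -> smooth_on U F ->
  (forall x, A x -> 0 < jac F x) ->
  bounded_lipschitz A (fun x => (jac F x)^-1 : R^o).
Proof.
move=> cA oU AU sF J0; apply: bounded_lipschitzV => // [x Ax|x Ax|].
- exact: (jac_continuous sF) (AU _ Ax).
- by rewrite gt_eqF ?J0.
have D i j := smooth_bounded_lipschitz i [:: j] cA oU AU sF.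
have m := bounded_lipschitzZ (D 0 1) (D 1 0).
have p := bounded_lipschitzZ (D 0 0) (D 1 1).
have := bounded_lipschitzD p (bounded_lipschitzZ (bounded_lipschitz_cst A (-1 : R^o)) m).
apply: eq_bounded_lipschitz => x _.
by rewrite /jac det_mx2 !mxE [(-1 : R) *: _]mulN1r.
Qed.

(** The identity [trmx_Kmx_mul] gives the inverse of the Jacobi matrix, hence a
    bound on it, without cofactors. *)
Lemma invmx_Kmx (R : realType) (D : 'M[R]_2) (v : 'cV[R]_2) : \det D != 0 ->
  invmx D *m v = - ((\det D)^-1 *: (Kmx R *m (D^T *m (Kmx R *m v)))).
Proof.
move=> D0; have uD : D \in unitmx by rewrite unitmxE unitfE.
have DKD w : D^T *m (Kmx R *m (D *m w)) = \det D *: (Kmx R *m w).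
  by rewrite !mulmxA trmx_Kmx_mul scalemxAl.
rewrite -{2}(mulKVmx uD v) DKD.
by rewrite -scalemxAr Kmx_sqr scalerA mulVf// scale1r opprK.
Qed.

Lemma trmx_Nmx_bounded (R : realType) (A U : set 'cV[R]_2)
    (F : 'cV[R]_2 -> 'cV[R]_2) :
  compact A -> open U -> A `<=` U -> smooth_on U F ->
  (forall x, A x -> 0 < jac F x) ->
  exists2 c : R, 0 <= c & forall x (v : 'cV[R]_2), A x -> `|(Nmx F x)^T *m v| <= c * `|v|.
Proof.
move=> cA oU AU sF J0.
have [k k0 Dk] := jacobi_mx_bounded_lipschitz cA oU AU sF.
have [l l0 Jl] := jacV_bounded_lipschitz cA oU AU sF J0.
exists (l * (2 * k)) => [|x v Ax]; first by rewrite !mulr_ge0.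
have Jn0 : \det (jacobi_mx F x) != 0 by rewrite gt_eqF// J0.
rewrite /Nmx trmxK invmx_Kmx// normrN normrZ norm_Kmx -mulrA.
rewrite ler_pM//; first by have [] := Jl x x Ax Ax.
apply: (le_trans (norm_mulmx_le _ _)).
rewrite norm_trmx norm_Kmx ler_wpM2r// ler_wpM2l//.
by have [] := Dk x x Ax Ax.
Qed.

(** The velocity [Kmx R *m G], with [G] the electric field, moves the point [y]
    in the direction of the guiding-center field. *)
Lemma gc_field_drift (R : realType) (F Et : 'cV[R]_2 -> 'cV[R]_2) (b0 : R) y :
  b0 != 0 -> jac F y != 0 ->
  (Nmx F y)^T *m (Kmx R *m (Nmx F y *m Et y)) = b0 *: gc_field F Et b0 y.
Proof.
move=> b00 J0; rewrite !mulmxA trmx_Kmx_mul /Nmx det_tr det_inv -/(jac F y).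
by rewrite -scalemxAl /gc_field scalerA invfM mulrA divff// mul1r.
Qed.

(** The Lipschitz bound is transported from [E] to [Et] through
    [Et = D^T E(F)], [D] the Jacobi matrix, which avoids the inverse of [D]. *)
Lemma gc_field_bounded_lipschitz (R : realType) (A U : set 'cV[R]_2)
    (F E Et : 'cV[R]_2 -> 'cV[R]_2) (b0 : R) :
  compact A -> open U -> A `<=` U -> smooth_on U F ->
  (forall x, A x -> 0 < jac F x) ->
  bounded_lipschitz A (E \o F) -> (forall y, A y -> E (F y) = Nmx F y *m Et y) ->
  bounded_lipschitz A (gc_field F Et b0).
Proof.
move=> cA oU AU sF J0 EF hEt.
have DT := bounded_lipschitz_trmx (jacobi_mx_bounded_lipschitz cA oU AU sF).
have JV := jacV_bounded_lipschitz cA oU AU sF J0.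
have := bounded_lipschitz_mulmx (bounded_lipschitz_cst A (Kmx R))
  (bounded_lipschitz_mulmx DT EF).
move/(bounded_lipschitzZ (bounded_lipschitzZ (bounded_lipschitz_cst A (b0^-1 : R^o)) JV)).
apply: eq_bounded_lipschitz => y Ay; rewrite /gc_field invfM; congr (_ *: (_ *m _)).
rewrite /= hEt// /Nmx mulmxA -trmx_mul mulVmx ?trmx1 ?mul1mx//.
by rewrite unitmxE unitfE gt_eqF ?J0.
Qed.

(** * The semi-implicit scheme *)

(** [Kmx] is an isometry of the max norm, so [`|a| * `|w| = `|w - z|]; when
    [`|a|] is at least two, [`|w|] is absorbed. *)
Lemma resolvent_le (R : realType) (z w : 'cV[R]_2) (a : R) :
  w = z + a *: (Kmx R *m w) -> 2 <= `|a| -> `|w| <= 2 / `|a| * `|z|.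
Proof.
move=> wE a2; have a0 : 0 < `|a| by lra.
have aw : `|a| * `|w| <= `|w| + `|z|.
  rewrite -(norm_Kmx w) -normrZ norm_Kmx.
  rewrite (_ : a *: (Kmx R *m w) = w - z); first exact: ler_normB.
  by rewrite {2}wE addrAC subrr add0r.
rewrite mulrAC ler_pdivlMr//.
have := normr_ge0 w; nra.
Qed.

(** The drift [(eps / b) *: (Kmx R *m g)] is the velocity at which the magnetic
    term balances the electric one, because [Kmx] squares to [-1]. *)
Lemma fast_part_step (R : realType) (v0 v1 g : 'cV[R]_2) (eps dt b : R) :
  eps != 0 -> b != 0 ->
  v1 = v0 + (dt / eps) *: g + (dt / eps ^+ 2 * b) *: (Kmx R *m v1) ->
  v1 - (eps / b) *: (Kmx R *m g) = v0 - (eps / b) *: (Kmx R *m g) +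
    (dt / eps ^+ 2 * b) *: (Kmx R *m (v1 - (eps / b) *: (Kmx R *m g))).
Proof.
move=> e0 b0 v1E; rewrite mulmxBr -scalemxAr Kmx_sqr scalerBr scalerN scalerN opprK.
rewrite scalerA (_ : dt / eps ^+ 2 * b * (eps / b) = dt / eps); last first.
  by field; rewrite e0 b0.
rewrite {1}v1E -!addrA; congr (v0 + _).
by rewrite addrA addrC; congr (_ + _); rewrite addrC.
Qed.

Lemma near_half (R : realType) (b c d : R) :
  `|c - b| <= d -> d <= `|b| / 2 -> `|b| / 2 <= `|c|.
Proof. by have := ler_normD c (b - c); rewrite addrC subrK distrC; lra. Qed.

(** The field [b] is only known to be close to a constant, not to be Lipschitz:
    its variation is bounded by [2 * d], where [d] will be [O(eps ^ 2)]. *)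
Lemma drift_variation (R : realType) (g g' : 'cV[R]_2) (eps b b' b0 d : R) :
  0 <= eps -> b0 != 0 -> `|b - b0| <= d -> `|b' - b0| <= d -> d <= `|b0| / 2 ->
  `|(eps / b) *: (Kmx R *m g) - (eps / b') *: (Kmx R *m g')| <=
    eps * (2 / `|b0| * `|g - g'| + 8 * d / `|b0| ^+ 2 * `|g'|).
Proof.
move=> e0 b00 bd bd' db; have B0 : 0 < `|b0| by rewrite normr_gt0.
have far c : `|c - b0| <= d -> `|b0| / 2 <= `|c|.
  by move=> cd; apply: near_half cd db.
have inv c : `|c - b0| <= d -> `|c^-1| <= 2 / `|b0|.
  move=> /far bc; rewrite normfV -[2 / _]invrK lef_pV2 ?posrE ?invr_gt0 ?divr_gt0//.
    by rewrite invf_div.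
  by apply: lt_le_trans bc; rewrite divr_gt0.
have nz c : `|c - b0| <= d -> c != 0.
  by move=> /far bc; rewrite -normr_gt0; apply: lt_le_trans bc; rewrite divr_gt0.
rewrite -!scalerA -scalerBr normrZ ger0_norm// ler_wpM2l//.
have -> : b^-1 *: (Kmx R *m g) - b'^-1 *: (Kmx R *m g') =
    b^-1 *: (Kmx R *m (g - g')) + (b^-1 * (b' - b) * b'^-1) *: (Kmx R *m g').
  rewrite (_ : b^-1 * (b' - b) * b'^-1 = b^-1 - b'^-1); last first.
    by field; rewrite !nz.
  by rewrite mulmxBr scalerBr scalerBl addrA subrK.
apply: (le_trans (ler_normD _ _)); rewrite !normrZ !norm_Kmx.
apply: lerD; first by rewrite ler_wpM2r// inv.
rewrite ler_wpM2r// ?normrM.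
have bb : `|b' - b| <= 2 * d.
  rewrite (_ : b' - b = (b' - b0) - (b - b0)); last by ring.
  by apply: (le_trans (ler_normB _ _)); lra.
rewrite (_ : 8 * d / `|b0| ^+ 2 = 2 / `|b0| * (2 * d) * (2 / `|b0|)); last first.
  by field; rewrite gt_eqF.
by rewrite !ler_pM ?mulr_ge0 ?inv.
Qed.

(** The fast part of the velocity is divided by a multiple of [lambda] at each
    step and recharged by the variation of the drift between two steps, which is
    [O(eps * dt)]; hence [dt / eps] times its sum is [O(eps ^ 2)] although
    [dt / eps] is not small. *)
Lemma semi_implicit_error (R : realType) (A : set 'cV[R]_2)
    (F Et : 'cV[R]_2 -> 'cV[R]_2) (b0 M T : R) :
  b0 != 0 -> 0 <= M -> 0 < T ->
  (forall x, A x -> 0 < jac F x) ->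
  (exists2 c : R, 0 <= c &
     forall x (w : 'cV[R]_2), A x -> `|(Nmx F x)^T *m w| <= c * `|w|) ->
  bounded_lipschitz A (fun x => Nmx F x *m Et x) ->
  bounded_lipschitz A (gc_field F Et b0) ->
  exists2 lambda0 : R, 0 < lambda0 & exists2 C : R, 0 <= C &
  forall (eps dt : R) (b : 'cV[R]_2 -> R) (y v u : nat -> 'cV[R]_2),
    0 < eps -> 0 < dt -> M * eps ^+ 2 <= `|b0| / 2 ->
    (forall z, A z -> `|b (F z) - b0| <= M * eps ^+ 2) ->
    (forall n : nat, n%:R * dt <= T -> A (y n) /\ A (u n)) ->
    semi_implicit_scheme F Et b eps dt T y v ->
    u 0%N = y 0%N ->
    guiding_center_scheme F Et b0 dt T u ->
    lambda0 <= dt / eps ^+ 2 ->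
    forall n : nat, n%:R * dt <= T ->
      `|y n - u n| <= C * (eps ^+ 2 * (1 + `|eps^-1 *: v 0%N -
        (b (F (y 0%N)))^-1 *: (Kmx R *m (Nmx F (y 0%N) *m Et (y 0%N)))|)).
Proof.
move=> b00 M0 T0 J0 [c c0 Nc] [k k0 Gk] [l l0 Rl].
set be := `|b0|; have be0 : 0 < be by rewrite normr_gt0.
have beW := ltW be0; have TW := ltW T0.
pose G x := Nmx F x *m Et x.
(* [q] and [B] are the growth of the fast part and the source term over a step;
   [lambda >= 8 * q / be] turns [q] times the contraction [4 / (lambda * be)] of
   the resolvent into at most one half. *)
pose q := 1 + 2 * k * c / be * T.
pose B := 4 * k * l / be + 8 * k * M / be ^+ 2.
have q1 : 1 <= q by rewrite lerDl !mulr_ge0 ?invr_ge0.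
have B0 : 0 <= B by rewrite addr_ge0 ?divr_ge0 ?mulr_ge0 ?exprn_ge0.
have q80 : 0 < 8 * q / be by rewrite divr_gt0 ?mulr_gt0//; lra.
exists (1 + 8 * q / be); first by rewrite addr_gt0.
pose C1 := T * (2 * M / be * l) + c * (8 / be) * (B * T).
have C10 : 0 <= C1.
  by rewrite addr_ge0 ?mulr_ge0 ?invr_ge0// !mulr_ge0 ?invr_ge0.
have C20 : 0 <= c * (8 / be) by rewrite mulr_ge0// divr_ge0.
have C30 := mulr_ge0 (expR_ge0 (T * l)) (addr_ge0 C10 C20).
exists (expR (T * l) * (C1 + c * (8 / be))) => [|eps dt b y v u].
  exact: C30.
move=> e0 dt0 Mb bM Ayu sch u0 gc lam n nT.
pose lambda := dt / eps ^+ 2; pose tau := dt / eps.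
have e20 : 0 < eps ^+ 2 by rewrite exprn_gt0.
have lamq : 8 * q / be <= lambda by apply: le_trans lam; rewrite lerDr.
have lam0 : 0 < lambda by exact: lt_le_trans lamq.
have edt : eps ^+ 2 <= dt.
  have : 1 <= lambda by apply: le_trans lam; rewrite lerDl ltW.
  by rewrite ler_pdivlMr// mul1r.
have tau0 : 0 < tau by rewrite divr_gt0.
have [[[eW dtW] lamW] tauW] := (ltW e0, ltW dt0, ltW lam0, ltW tau0).
have lb0 : 0 < lambda * be by rewrite mulr_gt0.
have lbW := ltW lb0.
have e2W := ltW e20.
have le_time (j : nat) : (j <= n)%N -> j%:R * dt <= T.
  move=> jn; apply: le_trans nT; rewrite ler_wpM2r//.
  by rewrite ler_nat.
have Ay j : (j <= n)%N -> A (y j) by move=> /le_time/Ayu[].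
have Au j : (j <= n)%N -> A (u j) by move=> /le_time/Ayu[].
have far j : (j <= n)%N -> be / 2 <= `|b (F (y j))|.
  by move=> jn; apply: near_half (bM _ (Ay j jn)) Mb.
have bj0 j : (j <= n)%N -> b (F (y j)) != 0.
  by move=> jn; rewrite -normr_gt0; apply: lt_le_trans (far j jn); rewrite divr_gt0.
pose dr j := (eps / b (F (y j))) *: (Kmx R *m G (y j)).
pose w j := v j.+1 - dr j.
have wle j : (j < n)%N -> `|w j| <= 4 / (lambda * be) * `|v j - dr j|.
  move=> jn; have [_ vS] := sch j (le_time _ jn).
  have wE : w j = (v j - dr j) + (lambda * b (F (y j))) *: (Kmx R *m w j).
    exact: fast_part_step (lt0r_neq0 e0) (bj0 j (ltnW jn)) vS.
  have lb : lambda * be / 2 <= `|lambda * b (F (y j))|.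
    by rewrite normrM gtr0_norm// -mulrA ler_pM2l// far// ltnW.
  have lq : 8 * q <= lambda * be by rewrite -ler_pdivrMr.
  have lb2 : 2 <= `|lambda * b (F (y j))| by lra.
  apply: (le_trans (resolvent_le wE lb2)); rewrite ler_wpM2r//.
  rewrite ler_pdivrMr; last by lra.
  by rewrite mulrAC ler_pdivlMr//; lra.
have yS j : (j < n)%N -> y j.+1 - y j =
    dt *: ((b0 / b (F (y j))) *: gc_field F Et b0 (y j)) +
    tau *: ((Nmx F (y j))^T *m w j).
  move=> jn; have [-> _] := sch j (le_time _ jn); rewrite addrAC subrr add0r.
  rewrite -{1}(subrK (dr j) (v j.+1)) -/(w j) mulmxDr scalerDr addrC; congr (_ + _).
  have J := lt0r_neq0 (J0 _ (Ay j (ltnW jn))).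
  rewrite /dr -scalemxAr /G (gc_field_drift Et b00 J) !scalerA; congr (_ *: _).
  by field; rewrite J b00 (bj0 _ (ltnW jn)) gt_eqF.
have ratio j : (j <= n)%N -> `|b0 / b (F (y j)) - 1| <= 2 * M / be * eps ^+ 2.
  move=> jn; rewrite (_ : b0 / _ - 1 = (b0 - b (F (y j))) / b (F (y j))); last first.
    by field; rewrite bj0.
  rewrite normrM normfV distrC ler_pdivrMr ?normr_gt0 ?bj0//.
  apply: (le_trans (bM _ (Ay j jn))).
  rewrite (_ : 2 * M / be * eps ^+ 2 = M * eps ^+ 2 / (be / 2)); last first.
    by field; rewrite gt_eqF.
  rewrite mulrAC ler_pdivlMr ?divr_gt0//.
  by apply: ler_wpM2l; [rewrite mulr_ge0 | exact: far].
have ratio2 j : (j <= n)%N -> `|b0 / b (F (y j))| <= 2.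
  move=> jn; rewrite normrM normfV ler_pdivrMr ?normr_gt0 ?bj0//.
  by have := far j jn; rewrite -/be; lra.
have dyle j : (j < n)%N -> `|y j.+1 - y j| <= 2 * l * dt + tau * c * `|w j|.
  move=> jn; rewrite yS//; apply: (le_trans (ler_normD _ _)); apply: lerD.
    rewrite normrZ gtr0_norm// mulrC ler_pM2r// normrZ ler_pM ?ratio2 1?ltnW//.
    by have [] := Rl _ _ (Ay j (ltnW jn)) (Ay j (ltnW jn)).
  by rewrite normrZ gtr0_norm// -mulrA ler_pM2l//; apply: Nc (Ay _ (ltnW jn)).
(* The variation of [b] is [O(eps ^ 2)], hence [O(dt)] since [lambda >= 1]. *)
have wS j : (j.+1 < n)%N -> `|w j.+1| <= `|w j| / 2 + 4 * B / (lambda * be) * (eps * dt).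
  move=> jn; have jn' := ltnW jn.
  have dz : `|v j.+1 - dr j.+1| <= q * `|w j| + B * (eps * dt).
    rewrite (_ : v j.+1 - dr j.+1 = w j + (dr j - dr j.+1)); last first.
      by rewrite /w addrA subrK.
    apply: (le_trans (ler_normD _ _)).
    have := drift_variation (G (y j)) (G (y j.+1)) eW b00
      (bM _ (Ay j (ltnW jn'))) (bM _ (Ay _ jn')) Mb.
    rewrite -/(dr j) -/(dr j.+1) -/be => ddr.
    have [_ Glip] := Gk _ _ (Ay j (ltnW jn')) (Ay _ jn').
    have [Gb _] := Gk _ _ (Ay _ jn') (Ay _ jn').
    have dy := dyle j jn'.
    have s1 : 2 / be * `|G (y j) - G (y j.+1)| <=
        2 / be * (k * (2 * l * dt + tau * c * `|w j|)).
      apply: ler_wpM2l; first by rewrite divr_ge0.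
      by apply: (le_trans Glip); rewrite ler_wpM2l// distrC.
    have s2 : 8 * (M * eps ^+ 2) / be ^+ 2 * `|G (y j.+1)| <=
        8 * (M * dt) / be ^+ 2 * k.
      rewrite ler_pM ?mulr_ge0 ?invr_ge0 ?exprn_ge0//.
      by rewrite ler_wpM2r ?invr_ge0 ?exprn_ge0// ler_wpM2l// ler_wpM2l.
    have s3 : eps * (2 / be * (k * (2 * l * dt + tau * c * `|w j|)) +
        8 * (M * dt) / be ^+ 2 * k) =
        2 * k * c / be * dt * `|w j| + B * (eps * dt).
      by rewrite /B /tau; field; rewrite !gt_eqF.
    have s4 : 2 * k * c / be * dt * `|w j| <= 2 * k * c / be * T * `|w j|.
      have dtT : dt <= T by have := le_time 1%N (leq_ltn_trans (leq0n j) jn'); rewrite mul1r.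
      by rewrite ler_wpM2r// ler_wpM2l// !mulr_ge0// invr_ge0.
    have s5 := ler_wpM2l eW (lerD s1 s2).
    by rewrite /q; lra.
  apply: (le_trans (wle _ jn)).
  apply: (le_trans (ler_wpM2l _ dz)); first by rewrite divr_ge0.
  rewrite mulrDr; apply: lerD.
    rewrite mulrA [leRHS]mulrC ler_wpM2r// mulrAC ler_pdivrMr//.
    have : 8 * q <= lambda * be by rewrite -ler_pdivrMr.
    lra.
  by rewrite le_eqVlt; apply/orP; left; apply/eqP; ring.
case: n nT le_time Ay Au far bj0 wle yS ratio ratio2 dyle wS => [|n] nT le_time Ay Au
  far bj0 wle yS ratio ratio2 dyle wS.
  by rewrite u0 subrr normr0; apply: mulr_ge0 C30 (mulr_ge0 e2W (addr_ge0 ler01 _)).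
set W := `|eps^-1 *: _ - _|.
have w0 : `|w 0%N| <= 4 / (lambda * be) * (eps * W).
  apply: (le_trans (wle 0%N (ltn0Sn n))).
  apply: ler_wpM2l; first by rewrite divr_ge0.
  rewrite (_ : v 0%N - dr 0%N = eps *: (eps^-1 *: v 0%N - (b (F (y 0%N)))^-1 *:
    (Kmx R *m G (y 0%N)))); first by rewrite normrZ gtr0_norm.
  by rewrite scalerBr !scalerA divff ?gt_eqF// scale1r.
(* The factor [tau * eps / lambda] is [eps ^+ 2]. *)
have sumw : tau * \sum_(j < n.+1) `|w j| <= 8 / be * (W + B * T) * eps ^+ 2.
  have := sum_halving wS => sw.
  have : \sum_(j < n.+1) `|w j| <= 8 / (lambda * be) * eps * (W + B * T).
    have nn : 4 * B / (lambda * be) * eps * (n%:R * dt) <= 4 * B / (lambda * be) * eps * T.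
      by apply: ler_wpM2l; [rewrite !mulr_ge0 ?invr_ge0 | exact: le_time].
    by have := normr_ge0 (w n); lra.
  move=> sw8; apply: (le_trans (ler_wpM2l tauW sw8)).
  rewrite le_eqVlt; apply/orP; left; apply/eqP.
  by rewrite /tau /lambda; field; rewrite !gt_eqF.
pose r j := dt * (2 * M / be * eps ^+ 2 * l) + tau * c * `|w j|.
have W0 : 0 <= W by exact: normr_ge0.
(* The second term is controlled by the Lipschitz bound on the guiding-center
   field, the third, with [rho] the ratio of [b0] to [b], by the maximal
   ordering, and the last one by the fast part of the velocity. *)
have split_error (p s a d x : 'cV[R]_2) (rho : R) :
    dt *: (rho *: p) + tau *: x + a - (d + dt *: s) =
    (a - d) + dt *: (p - s) + dt *: ((rho - 1) *: p) + tau *: x.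
  by apply/colP => i; rewrite !mxE; ring.
have eS j : (j < n.+1)%N ->
    `|y j.+1 - u j.+1| <= (1 + dt * l) * `|y j - u j| + r j.
  move=> jn; rewrite gc ?le_time//.
  rewrite -(subrK (y j) (y j.+1)) yS// split_error.
  have [Aj Auj] := (Ay j (ltnW jn), Au j (ltnW jn)).
  have [Rb _] := Rl _ _ Aj Aj; have [_ Rlip] := Rl _ _ Aj Auj.
  apply: (le_trans (ler_normD _ _)); rewrite /r addrA; apply: lerD; last first.
    by rewrite normrZ gtr0_norm// -mulrA ler_pM2l//; apply: Nc Aj.
  apply: (le_trans (ler_normD _ _)); apply: lerD; last first.
    rewrite normrZ gtr0_norm// ler_pM2l// normrZ.
    by apply: ler_pM => //; apply: ratio; exact: ltnW.
  apply: (le_trans (ler_normD _ _)); rewrite mulrDl mul1r lerD2l.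
  by rewrite normrZ gtr0_norm// -mulrA ler_pM2l.
have r0 j : (j < n.+1)%N -> 0 <= r j.
  by move=> _; rewrite addr_ge0// !mulr_ge0 ?invr_ge0.
have e00 : `|y 0%N - u 0%N| = 0 by rewrite u0 subrr normr0.
have dtl : 0 <= dt * l by rewrite mulr_ge0.
apply: (le_trans (discrete_gronwall dtl r0 e00 eS)); rewrite -mulrA.
have rsum : \sum_(j < n.+1) r j =
    n.+1%:R * dt * (2 * M / be * l) * eps ^+ 2 + c * (tau * \sum_(j < n.+1) `|w j|).
  rewrite big_split/= sumr_const card_ord -mulr_sumr -mulr_natl; congr (_ + _); ring.
have sum0 : 0 <= \sum_(j < n.+1) r j by apply: sumr_ge0 => j _; exact: r0.
apply: ler_pM => //.
  by rewrite ler_expR mulrA ler_wpM2r.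
rewrite rsum.
have s1 : n.+1%:R * dt * (2 * M / be * l) * eps ^+ 2 <= T * (2 * M / be * l) * eps ^+ 2.
  by rewrite !ler_wpM2r// !mulr_ge0 ?invr_ge0.
have s2 := ler_wpM2l c0 sumw.
apply: (le_trans (lerD s1 s2)).
have -> : T * (2 * M / be * l) * eps ^+ 2 + c * (8 / be * (W + B * T) * eps ^+ 2) =
  (C1 + c * (8 / be) * W) * eps ^+ 2 by rewrite /C1; ring.
rewrite [leRHS]mulrCA [leLHS]mulrC ler_wpM2l// mulrDr mulr1.
have := mulr_ge0 C10 W0; lra.
Qed.

(** * The error estimate *)

Unset Implicit Arguments.

Theorem theorem4p2 (R : realType)
    (Oy Ox : set 'cV[R]_2) (F : 'cV[R]_2 -> 'cV[R]_2)
    (E Et : 'cV[R]_2 -> 'cV[R]_2) (bbar : 'cV[R]_2 -> R) (T : R)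
    (hOy : compact Oy) (hOx : compact Ox)
    (hF : orthogonal_coordinates Oy Ox F)
    (hE : W1infty_on Ox E)
    (hEt : forall y, Oy y -> E (F y) = Nmx F y *m Et y)
    (hb0 : bbar 0 != 0)
    (hbord : exists M : R, forall (eps : R) (y : 'cV[R]_2),
       0 < eps <= 1 -> Oy y -> `|bbar (eps *: y) - bbar 0| <= M * eps ^+ 2)
    (hT : 0 < T) :
  exists2 lambda0 : R, 0 < lambda0 &
  exists2 C : R, 0 < C &
  forall (eps dt : R) (b : 'cV[R]_2 -> R) (y v u : nat -> 'cV[R]_2),
    0 < eps -> 0 < dt ->
    (forall z, Oy z -> b (F z) = bbar (eps *: z)) ->
    (forall n : nat, n%:R * dt <= T -> Oy (y n) /\ Oy (u n)) ->
    semi_implicit_scheme F Et b eps dt T y v ->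
    u 0%N = y 0%N ->
    guiding_center_scheme F Et (bbar 0) dt T u ->
    lambda0 <= dt / eps ^+ 2 ->
    forall n : nat, n%:R * dt <= T ->
      enorm (y n - u n) <=
        C * (eps ^+ 2 *
          (1 + enorm (eps^-1 *: v 0%N
                 - (b (F (y 0%N)))^-1 *: (Kmx R *m (Nmx F (y 0%N) *m Et (y 0%N)))))).
Proof.
have [[FOx _ _] [U [oU OyU sF]] _ J0] := hF.
have EF : bounded_lipschitz Oy (E \o F).
  apply: (bounded_lipschitz_comp (B := Ox)) (W1infty_bounded_lipschitz hE).
    by move=> x Ox'; apply: FOx.
  apply: bounded_lipschitz_matrix => i j; rewrite (ord1 j).
  exact: (smooth_bounded_lipschitz i [::] hOy oU OyU sF).
have Gbl := eq_bounded_lipschitz hEt EF.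
have Rbl := gc_field_bounded_lipschitz (bbar 0) hOy oU OyU sF J0 EF hEt.
have Nb := trmx_Nmx_bounded hOy oU OyU sF J0.
have [M0 hM0] := hbord; pose M := `|M0| + 1.
have Mpos : 0 < M by rewrite ltr_wpDl.
have hM eps z : 0 < eps <= 1 -> Oy z -> `|bbar (eps *: z) - bbar 0| <= M * eps ^+ 2.
  move=> e01 Oz; apply: (le_trans (hM0 eps z e01 Oz)); rewrite ler_wpM2r ?sqr_ge0//.
  by rewrite (le_trans (ler_norm _))// lerDl.
have [lambda0 l0 [C0 C00 C0P]] := semi_implicit_error hb0 (ltW Mpos) hT J0 Nb Gbl Rbl.
have [k k0 Ok] := continuous_bounded_on_compact (f := id) hOy (fun x _ => cvg_id).
(* Below [delta], [eps] is at most one and [b] stays within [`|bbar 0| / 2] of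
   [bbar 0]; above it, the boundedness of [Oy] is enough. *)
pose delta := Num.min 1 (`|bbar 0| / 2 / M).
have d0 : 0 < delta by rewrite lt_min ltr01 !divr_gt0 ?normr_gt0.
exists lambda0 => //; exists (2 * C0 + 4 * k / delta + 1).
  by rewrite ltr_wpDl// addr_ge0 ?mulr_ge0 ?invr_ge0// ltW.
move=> eps dt b y v u e0 dt0 hb Oyu sch u0 gc lam n nT.
set W := _ - _ *: _; have W0 := le_trans (normr_ge0 _) (norm_le_enorm W).
have e2W : 0 <= eps ^+ 2 by rewrite sqr_ge0.
have rhs0 : 0 <= eps ^+ 2 * (1 + enorm W) by rewrite mulr_ge0// addr_ge0.
apply: (le_trans (enorm_le_norm _)).
have [esmall|ebig] := leP (eps ^+ 2) delta.
  move: esmall; rewrite le_min => /andP[e1]; rewrite ler_pdivlMr// mulrC => eM.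
  have e01 : 0 < eps <= 1 by rewrite e0 -(@ler_pXn2r _ 2)// ?nnegrE ?expr1n// ltW.
  have bM z : Oy z -> `|b (F z) - bbar 0| <= M * eps ^+ 2.
    by move=> Oz; rewrite hb//; exact: hM.
  have h := C0P eps dt b y v u e0 dt0 eM bM Oyu sch u0 gc lam n nT.
  apply: (le_trans (ler_wpM2l (ler0n _ 2) h)); rewrite [leLHS]mulrA.
  apply: ler_pM; [by rewrite mulr_ge0 | by rewrite mulr_ge0// addr_ge0 | |].
    by rewrite -addrA lerDl addr_ge0// !mulr_ge0 ?invr_ge0// ltW.
  by rewrite ler_wpM2l// lerD2l norm_le_enorm.
have [Oyn Oun] := Oyu n nT.
have yu : `|y n - u n| <= 2 * k.
  by apply: (le_trans (ler_normB _ _)); have := Ok _ Oyn; have := Ok _ Oun => /=; lra.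
apply: (@le_trans _ _ (4 * k / delta * (eps ^+ 2 * (1 + enorm W)))); last first.
  rewrite ler_wpM2r// [2 * C0 + _]addrC -addrA lerDl addr_ge0// mulr_ge0//.
apply: (@le_trans _ _ (4 * k / delta * delta)).
  by rewrite divfK ?gt_eqF//; lra.
rewrite ler_wpM2l ?mulr_ge0 ?invr_ge0 ?(ltW d0)//.
by apply: (le_trans (ltW ebig)); rewrite ler_peMr// lerDl.
Qed.
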